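(* Let $\mathfrak M$ be any model of $\mathsf{I\Delta_0+EXP}$. Then $\langle\mathbf R^{\mathfrak M},+,\cdot,0,1,{<},2^x\rangle$ is a real-closed exponential field, and $\mathfrak M$ (more precisely, the discretely ordered ring $\mathbf Z^{\mathfrak M}$) is an exponential integer part of it.
   Context: $\mathsf{I\Delta_0+EXP}$ is the theory of nonnegative parts of discretely ordered rings in the language $\langle+,\cdot,0,1,<\rangle$ with induction for bounded ($\Delta_0$) formulas, together with the axiom $\mathsf{EXP}$ stating that the ($\Delta_0$-definable) function $n\mapsto2^n$ is total. For $\mathfrak M\vDash\mathsf{I\Delta_0+EXP}$: $\mathbf N^{\mathfrak M}$ is the semiring $\mathfrak M$; $\mathbf Z^{\mathfrak M}$ is the discretely ordered ring obtained by adding negatives; $\mathbf Q^{\mathfrak M}$ is the ordered fraction field of $\mathbf Z^{\mathfrak M}$; $\mathbf R^{\mathfrak M}$ is the completion of the ordered field $\mathbf Q^{\mathfrak M}$ (the ordered field, unique up to isomorphism over $\mathbf Q^{\mathfrak M}$, that contains $\mathbf Q^{\mathfrak M}$ as a dense subfield and is complete as a uniform space in its order topology). It is known that $\mathbf R^{\mathfrak M}$ is a real-closed field with integer part $\mathbf Z^{\mathfrak M}$. By a theorem of Jeřábek (known background; $\mathsf{I\Delta_0+EXP}$ is essentially identical to the theory $\mathsf{VTC^0+EXP}$ for which it is formulated), the function $2^n\colon\mathbf N^{\mathfrak M}\to\mathbf N^{\mathfrak M}$ extends to an ordered group isomorphism $2^x\colon\langle\mathbf R^{\mathfrak M},+,0,<\rangle\to\langle\mathbf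 R^{\mathfrak M}_{>0},\cdot,1,<\rangle$; $2^x$ in the claim denotes this function. An integer part (IP) of an ordered ring $R$ is a subring $Z\subseteq R$ with $1=\min Z_{>0}$ such that every $x\in R$ satisfies $|x-n|\le1$ for some $n\in Z$. An exponential field is an ordered field $R$ with an ordered group isomorphism $\exp\colon\langle R,+,0,<\rangle\to\langle R_{>0},\cdot,1,<\rangle$. A real-closed exponential field is an exponential field that is real-closed as a field and satisfies $\exp(1)=2$ and $\exp(x)>x$ for all $x\in R$. An exponential integer part of an exponential field $\langle R,\exp\rangle$ is an IP $Z\subseteq R$ such that $Z_{>0}$ is closed under $\exp$. *)

(* Defs.v *)
From mathcomp Require Import all_boot all_order all_algebra.
From mathcomp Require Import boolp classical_sets topology normedtype.

Set Implicit Arguments.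
Unset Strict Implicit.
Unset Printing Implicit Defensive.

Import Order.TTheory GRing.Theory Num.Theory.
Import numFieldNormedType.Exports.

Local Open Scope classical_set_scope.
Local Open Scope ring_scope.

(** * Structures for the language <+, *, 0, 1, <> *)

Record arith_struct : Type := ArithStruct {
  carrier :> Type;
  azero : carrier;
  aone : carrier;
  aadd : carrier -> carrier -> carrier;
  amul : carrier -> carrier -> carrier;
  alt : carrier -> carrier -> Prop
}.

Declare Scope arith_scope.
Delimit Scope arith_scope with A.
Notation "0" := (azero _) : arith_scope.
Notation "1" := (aone _) : arith_scope.
Notation "2" := (aadd (aone _) (aone _)) : arith_scope.
Notation "4" := (amul (aadd (aone _) (aone _)) (aadd (aone _) (aone _)))
  : arith_scope.
Notation "x + y" := (aadd x y) : arith_scope.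
Notation "x * y" := (amul x y) : arith_scope.
Notation "x < y" := (alt x y) : arith_scope.
Notation "x <= y" := (alt x y \/ x = y) : arith_scope.

(* PA^-: its models are exactly the nonnegative parts of discretely ordered
   (commutative) rings. *)
Record PAminus (M : arith_struct) : Prop := {
  pa_addA : forall x y z : M, (x + (y + z) = (x + y) + z)%A;
  pa_addC : forall x y : M, (x + y = y + x)%A;
  pa_addx0 : forall x : M, (x + 0 = x)%A;
  pa_mulA : forall x y z : M, (x * (y * z) = (x * y) * z)%A;
  pa_mulC : forall x y : M, (x * y = y * x)%A;
  pa_mulx1 : forall x : M, (x * 1 = x)%A;
  pa_mulx0 : forall x : M, (x * 0 = 0)%A;
  pa_mulD : forall x y z : M, (x * (y + z) = x * y + x * z)%A;
  pa_lt_irr : forall x : M, ~ (x < x)%A;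
  pa_lt_trans : forall x y z : M, (x < y)%A -> (y < z)%A -> (x < z)%A;
  pa_lt_total : forall x y : M, (x < y)%A \/ x = y \/ (y < x)%A;
  pa_lt_add : forall x y z : M, (x < y)%A -> (x + z < y + z)%A;
  pa_lt_mul : forall x y z : M, (0 < z)%A -> (x < y)%A -> (x * z < y * z)%A;
  pa_sub : forall x y : M, (x < y)%A -> exists z : M, (x + z = y)%A;
  pa_lt01 : (azero M < aone M)%A;
  pa_discrete : forall x : M, (0 < x)%A -> (1 <= x)%A;
  pa_ge0 : forall x : M, (0 <= x)%A
}.

(** * Bounded formulas and Delta_0 induction *)

Inductive term : Type :=
| TVar of nat
| TZero
| TOne
| TAdd of term & term
| TMul of term & term.

(* Variables are de Bruijn indices.  [FAll t phi] is "for all x <= t, phi":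
   in [phi] the bound x is variable 0 and the outer variables are shifted by
   one, whereas [t] lives in the outer context, so that x does not occur in
   the bound. *)
Inductive bformula : Type :=
| FEq of term & term
| FLt of term & term
| FNot of bformula
| FAnd of bformula & bformula
| FOr of bformula & bformula
| FImp of bformula & bformula
| FAll of term & bformula
| FEx of term & bformula.

Definition scons (M : arith_struct) (x : M) (v : nat -> M) (n : nat) : M :=
  if n is n'.+1 then v n' else x.

Fixpoint teval (M : arith_struct) (v : nat -> M) (t : term) : M :=
  match t with
  | TVar n => v n
  | TZero => 0%A
  | TOne => 1%A
  | TAdd t1 t2 => (teval v t1 + teval v t2)%A
  | TMul t1 t2 => (teval v t1 * teval v t2)%A
  end.

Fixpoint sat (M : arith_struct) (v : nat -> M) (phi : bformula) : Prop :=
  match phi with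
  | FEq t1 t2 => teval v t1 = teval v t2
  | FLt t1 t2 => (teval v t1 < teval v t2)%A
  | FNot p => ~ sat v p
  | FAnd p q => sat v p /\ sat v q
  | FOr p q => sat v p \/ sat v q
  | FImp p q => sat v p -> sat v q
  | FAll t p => forall x : M, (x <= teval v t)%A -> sat (scons x v) p
  | FEx t p => exists2 x : M, (x <= teval v t)%A & sat (scons x v) p
  end.

(* The valuation [v] supplies the parameters. *)
Definition Delta0_induction (M : arith_struct) : Prop :=
  forall (phi : bformula) (v : nat -> M),
    sat (scons 0%A v) phi ->
    (forall x : M, sat (scons x v) phi -> sat (scons (x + 1)%A v) phi) ->
    forall x : M, sat (scons x v) phi.

(** * The graph of n |-> 2 ^ n

   This is the classical Delta_0 definition by repeated squaring.  Writing
   u_i = 2 ^ (2 ^ i), put x_i = the number formed by the i leading binary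
   digits of x, and y_i = 2 ^ x_i; thus x_1 = 1, y_1 = 2, x_(i+1) is 2 x_i or
   2 x_i + 1, and y_(i+1) is correspondingly y_i ^ 2 or 2 y_i ^ 2.  The
   numbers X and Y code the two sequences: x_i and y_i are stored in the block
   of 2 ^ i binary digits of X, respectively Y, starting at digit 2 ^ i.  All
   quantifiers are bounded by terms; see [pow2_graph_Delta0]. *)

Definition adivides (M : arith_struct) (r a : M) : Prop :=
  exists2 q : M, (q <= a)%A & (a = r * q)%A.

Definition is_pow2 (M : arith_struct) (a : M) : Prop :=
  (0 < a)%A /\
  forall r : M, (r <= a)%A -> (1 < r)%A -> adivides r a -> adivides 2%A r.

(* floor (a / i) is odd; for i = 2 ^ k, the k-th binary digit of a is 1 *)
Definition bit_at (M : arith_struct) (i a : M) : Prop :=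
  exists2 q : M, (q <= a)%A & exists2 r : M, (r <= a)%A &
    (r < i)%A /\ (a = (2 * q + 1) * i + r)%A.

(* m = u_1 + u_2 + ... + u_k for some k >= 0 *)
Definition is_tower_sum (M : arith_struct) (m : M) : Prop :=
  ~ bit_at 1%A m /\ ~ bit_at 2%A m /\
  forall i : M, (i <= m)%A -> is_pow2 i -> (2 < i)%A ->
    (bit_at i m <->
     i = 4%A \/ exists2 s : M, (s <= i)%A & i = (s * s)%A /\ bit_at s m).

(* u = u_i for some i >= 1 *)
Definition is_tower (M : arith_struct) (u : M) : Prop :=
  is_pow2 u /\
  exists2 m : M, (m <= 2 * u)%A & is_tower_sum m /\ bit_at u m.

(* w = floor (z / u) mod u *)
Definition block (M : arith_struct) (u z w : M) : Prop :=
  exists2 a : M, (a <= z)%A & exists2 b : M, (b <= z)%A &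
    (w < u)%A /\ (b < u)%A /\ (z = (a * u + w) * u + b)%A.

Definition pow2_steps (M : arith_struct) (y X Y : M) : Prop :=
  forall u : M, (u <= y)%A -> is_tower u ->
  exists2 a : M, (a <= u)%A & exists2 b : M, (b <= u)%A &
    block u X a /\ block u Y b /\
    ((block (u * u)%A X (2 * a)%A /\ block (u * u)%A Y (b * b)%A) \/
     (block (u * u)%A X (2 * a + 1)%A /\ block (u * u)%A Y (2 * (b * b))%A)).

Definition pow2_graph (M : arith_struct) (x y : M) : Prop :=
  (x = 0%A /\ y = 1%A) \/
  exists2 X : M, (X <= (y * y) * (y * y))%A &
  exists2 Y : M, (Y <= (y * y) * (y * y))%A &
    block 4%A X 1%A /\ block 4%A Y 2%A /\ pow2_steps y X Y /\
    exists2 u : M, (u <= y * y)%A &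
      is_tower u /\ block u X x /\ block u Y y.

Definition EXP (M : arith_struct) : Prop :=
  forall x : M, exists y : M, pow2_graph x y.

Definition IDelta0_EXP (M : arith_struct) : Prop :=
  [/\ PAminus M, Delta0_induction M & EXP M].

(* [pow2_graph] as a bounded formula.  A term passed under [k] bounded
   quantifiers has its variables shifted by [k]. *)
Fixpoint tshift (k : nat) (t : term) : term :=
  match t with
  | TVar n => TVar (k + n)
  | TZero => TZero
  | TOne => TOne
  | TAdd t1 t2 => TAdd (tshift k t1) (tshift k t2)
  | TMul t1 t2 => TMul (tshift k t1) (tshift k t2)
  end.

Definition FIff (p q : bformula) : bformula := FAnd (FImp p q) (FImp q p).
Definition T2 : term := TAdd TOne TOne.
Definition T4 : term := TMul T2 T2.

Definition Fdivides (r a : term) : bformula :=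
  FEx a (FEq (tshift 1 a) (TMul (tshift 1 r) (TVar 0))).

Definition Fis_pow2 (a : term) : bformula :=
  FAnd (FLt TZero a)
    (FAll a (FImp (FLt TOne (TVar 0))
      (FImp (Fdivides (TVar 0) (tshift 1 a)) (Fdivides T2 (TVar 0))))).

Definition Fbit_at (i a : term) : bformula :=
  FEx a (FEx (tshift 1 a)
    (FAnd (FLt (TVar 0) (tshift 2 i))
      (FEq (tshift 2 a)
        (TAdd (TMul (TAdd (TMul T2 (TVar 1)) TOne) (tshift 2 i)) (TVar 0))))).

Definition Fis_tower_sum (m : term) : bformula :=
  FAnd (FNot (Fbit_at TOne m)) (FAnd (FNot (Fbit_at T2 m))
    (FAll m (FImp (Fis_pow2 (TVar 0)) (FImp (FLt T2 (TVar 0))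
      (FIff (Fbit_at (TVar 0) (tshift 1 m))
        (FOr (FEq (TVar 0) T4)
          (FEx (TVar 0) (FAnd (FEq (TVar 1) (TMul (TVar 0) (TVar 0)))
            (Fbit_at (TVar 0) (tshift 2 m)))))))))).

Definition Fis_tower (u : term) : bformula :=
  FAnd (Fis_pow2 u)
    (FEx (TMul T2 u)
      (FAnd (Fis_tower_sum (TVar 0)) (Fbit_at (tshift 1 u) (TVar 0)))).

Definition Fblock (u z w : term) : bformula :=
  FEx z (FEx (tshift 1 z)
    (FAnd (FLt (tshift 2 w) (tshift 2 u)) (FAnd (FLt (TVar 0) (tshift 2 u))
      (FEq (tshift 2 z)
        (TAdd (TMul (TAdd (TMul (TVar 1) (tshift 2 u)) (tshift 2 w))
                    (tshift 2 u))
              (TVar 0)))))).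

Definition Fpow2_steps (y X Y : term) : bformula :=
  FAll y (FImp (Fis_tower (TVar 0))
    (FEx (TVar 0) (FEx (TVar 1)
      (let u := TVar 2 in let a := TVar 1 in let b := TVar 0 in
       let uu := TMul u u in let X := tshift 3 X in let Y := tshift 3 Y in
       FAnd (Fblock u X a) (FAnd (Fblock u Y b)
         (FOr (FAnd (Fblock uu X (TMul T2 a)) (Fblock uu Y (TMul b b)))
              (FAnd (Fblock uu X (TAdd (TMul T2 a) TOne))
                    (Fblock uu Y (TMul T2 (TMul b b)))))))))).

(* x is variable 0, y is variable 1 *)
Definition Fpow2_graph : bformula :=
  FOr (FAnd (FEq (TVar 0) TZero) (FEq (TVar 1) TOne))
    (FEx (TMul (TMul (TVar 1) (TVar 1)) (TMul (TVar 1) (TVar 1)))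
    (FEx (TMul (TMul (TVar 2) (TVar 2)) (TMul (TVar 2) (TVar 2)))
      (let x := TVar 2 in let y := TVar 3 in
       let X := TVar 1 in let Y := TVar 0 in
       FAnd (Fblock T4 X TOne) (FAnd (Fblock T4 Y T2)
         (FAnd (Fpow2_steps y X Y)
           (FEx (TMul y y)
             (FAnd (Fis_tower (TVar 0))
               (FAnd (Fblock (TVar 0) (tshift 1 X) (tshift 1 x))
                     (Fblock (TVar 0) (tshift 1 Y) (tshift 1 y)))))))))).

Lemma pow2_graph_Delta0 (M : arith_struct) (v : nat -> M) :
  sat v Fpow2_graph <-> pow2_graph (v 0%N) (v 1%N).
Proof. exact: iff_refl. Qed.

(** * Z^M, Q^M and R^M

   They are given by their defining properties, which determine them up to a
   unique isomorphism over M. *)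

(* Z is a discretely ordered ring with nonnegative part i(M): the positive
   elements of Z are those of M, so discreteness of Z is that of M. *)
Record is_integers_of (M : arith_struct) (Z : realDomainType) (i : M -> Z)
    : Prop := {
  integers_of0 : i 0%A = 0;
  integers_of1 : i 1%A = 1;
  integers_ofD : forall x y : M, i (x + y)%A = i x + i y;
  integers_ofM : forall x y : M, i (x * y)%A = i x * i y;
  integers_of_lt : forall x y : M, i x < i y <-> (x < y)%A;
  integers_of_range : range i = [set z | 0 <= z]
}.

Record is_ordered_fraction_field (Z : realDomainType) (Q : realFieldType)
    (j : {rmorphism Z -> Q}) : Prop := {
  fraction_field_mono : {mono j : x y / x <= y};
  fraction_field_quot : forall q : Q, exists a b : Z, b != 0 /\ q = j a / j b
}.

(* [R] carries its order topology, with the uniformity given by the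
   entourages |x - y| < e for e > 0 in [R]. *)
Record is_ordered_field_completion (Q R : realFieldType)
    (k : {rmorphism Q -> R}) : Prop := {
  completion_mono : {mono k : x y / x <= y};
  completion_dense : dense (range k);
  completion_cauchy : forall F : set_system R,
    ProperFilter F -> cauchy F -> cvg F
}.

(** * Integer parts and exponential fields *)

Record integer_part (R : realDomainType) (Z : set R) : Prop := {
  integer_part_subring : subring_closed (mem Z);
  integer_part_min : forall z : R, Z z -> 0 < z -> 1 <= z;
  integer_part_approx : forall x : R, exists2 n : R, Z n & `|x - n| <= 1
}.

(* ordered group isomorphism from (R, +, 0, <) to (R_{>0}, *, 1, <) *)
Record exponential_field (R : realFieldType) (exp : R -> R) : Prop := {
  exponential_gt0 : forall x : R, 0 < exp x;
  exponential_surj : forall y : R, 0 < y -> exists x : R, exp x = y;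
  exponential0 : exp 0 = 1;
  exponentialD : forall x y : R, exp (x + y) = exp x * exp y;
  exponential_mono : {mono exp : x y / x < y}
}.

Record real_closed_exponential_field (R : realFieldType) (exp : R -> R)
    : Prop := {
  rcef_exponential : exponential_field exp;
  rcef_real_closed : Num.real_closed_axiom R;
  rcef_exp1 : exp 1 = 2;
  rcef_exp_gt : forall x : R, x < exp x
}.

Record exponential_integer_part (R : realFieldType) (exp : R -> R) (Z : set R)
    : Prop := {
  eip_integer_part : integer_part Z;
  eip_closed : forall z : R, Z z -> 0 < z -> Z (exp z) /\ 0 < exp z
}.

(* Main.v *)
Require Import Defs.
From mathcomp Require Import all_boot all_order all_algebra.
From mathcomp Require Import boolp classical_sets filter topology normedtype.
From mathcomp Require Import lra ring.
From mathcomp Require Import cauchyreals.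

(** Open induction in M gives a discrete intermediate value property for
    polynomials over Z: a sign change occurs between two consecutive integers.
    As Z is an integer part of R, real coefficients and points can be
    approximated by fractions with a common denominator, so that a polynomial
    over R with a sign change on [[a, b]] takes arbitrarily small values there.
    The points with small values lie in boundedly many small balls, hence an
    ultrafilter containing all these sets is Cauchy, and its limit is a root.

    An exponential extending [2 ^ n] maps integers to integers; [n < 2 ^ n]
    follows by Delta_0 induction and passes to R by monotonicity, using
    [n + 1 <= 2 ^ n] at the integer part [n] of a positive [x]. *)

Set Implicit Arguments.
Unset Strict Implicit.
Unset Printing Implicit Defensive.

Import Order.TTheory GRing.Theory Num.Theory.
Import numFieldNormedType.Exports.

Local Open Scope classical_set_scope.
Local Open Scope ring_scope.

(** * Real-closedness of a complete field from small values of polynomials *)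

Lemma poly_lipschitz (R : realFieldType) (p : {poly R}) (B : R) :
  exists2 L : R, 0 < L &
    forall x y, `|x| <= B -> `|y| <= B -> `|p.[y] - p.[x]| <= L * `|y - x|.
Proof.
exists (poly_accr_bound p 0 B); first exact: poly_accr_bound_gt0.
by move=> x y hx hy; rewrite mulrC poly_accr_bound1P // subr0.
Qed.

(* Replacing [p] by [(p - p.[y]) / ('X - y)] drops the degree by one and
   multiplies the values at the remaining points by at most [2 / d]. *)
Lemma separated_points_bound (R : realFieldType) (d e : R) (s : seq R) :
    0 < d -> 0 <= e -> pairwise (fun x y => d <= `|x - y|) s ->
  forall p : {poly R}, size p = size s -> {in s, forall x, `|p.[x]| <= e} ->
  `|lead_coef p| <= (2 / d) ^+ (size s).-1 * e.
Proof.
move=> d0; elim: s e => [|y s IHs] e e0.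
  move=> _ p /eqP; rewrite size_poly_eq0 => /eqP-> _.
  by rewrite lead_coef0 normr0 mul1r.
rewrite pairwise_cons => /andP[/allP sep_y sep_s] p /= sz_p p_le.
have p_ley : `|p.[y]| <= e by apply: p_le; rewrite mem_head.
have [q pE] : exists q, p - p.[y]%:P = q * ('X - y%:P).
  by apply/factor_theorem; rewrite /root !hornerE subrr.
have sz_py : (size (p - p.[y]%:P)%R <= (size s).+1)%N.
  rewrite (leq_trans (size_polyD _ _)) // sz_p size_polyN size_polyC.
  by rewrite geq_max leqnn; case: (p.[y] != 0).
(* Here [p] is constant; it is treated apart because subtracting [p.[y]] would cancel its leading
   coefficient. *)
have [s0|s_neq0] := eqVneq s [::].
  move: sz_p; rewrite s0 /= expr0 mul1r => /eqP/size_poly1P[c c0 pc].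
  by rewrite pc lead_coefC; move: p_ley; rewrite pc hornerC.
have sz_s : (0 < size s)%N by rewrite lt0n size_eq0.
have sz_C : (size (- p.[y]%:P)%R < size p)%N.
  by rewrite size_polyN size_polyC sz_p; case: (p.[y] != 0).
have szq : size q = size s.
  have : size (p - p.[y]%:P) = (size s).+1 by rewrite size_polyDl // sz_p.
  have [q0|q0] := eqVneq q 0; first by rewrite pE q0 mul0r size_poly0.
  by rewrite pE size_Mmonic ?monicXsubC // size_XsubC addn2 /= => -[].
have lead_q : lead_coef q = lead_coef p.
  by rewrite -(lead_coef_Mmonic q (monicXsubC y)) -pE lead_coefDl.
have q_le : {in s, forall x, `|q.[x]| <= 2 / d * e}.
  move=> x xs; have dxy : d <= `|x - y| by rewrite distrC sep_y.
  have /(congr1 (fun r => `|r.[x]|)) := pE; rewrite !hornerE normrM => qE.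
  have : `|p.[x] - p.[y]| <= e + e.
    rewrite (le_trans (ler_normB _ _)) // lerD //.
    by apply: p_le; rewrite in_cons xs orbT.
  rewrite qE -mulr2n -[e *+ 2]mulr_natl => h.
  rewrite mulrAC ler_pdivlMr //; apply: le_trans h.
  by rewrite ler_wpM2l.
have de0 : 0 <= 2 / d * e by rewrite mulr_ge0 // divr_ge0 // ltW.
have := IHs _ de0 sep_s _ szq q_le.
by rewrite lead_q mulrA; case: (size s) sz_s => // n _; rewrite -exprSr.
Qed.

(** An ultrafilter that contains no ball of radius [d] contains the complement of each one. The
    complements of the balls around the points chosen so far therefore meet [S], which yields one
    more point. *)
Lemma ultra_separated (R : realFieldType) (F : set_system R) (d : R)
    (S : set R) :
    UltraFilter F -> (forall x, ~ F (ball x d)) -> F S -> forall n,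
  exists s : seq R, [/\ size s = n, pairwise (fun x y => d <= `|x - y|) s
    & {in s, forall x, S x}].
Proof.
move=> FU Fball FS; elim=> [|n [s [sz_s sep_s sS]]]; first by exists [::].
have FP : ProperFilter F by apply: ultra_proper.
have Ffar : F [set x | {in s, forall y, d <= `|x - y|}].
  elim: s {sz_s sep_s sS} => [|y s IHs]; first by apply: filterS filterT.
  have [/Fball//|Fy] := in_ultra_setVsetC (ball y d) FU.
  apply: filterS (filterI Fy IHs) => x [/= hy hs] z.
  rewrite in_cons => /predU1P[->|/hs//].
  by rewrite leNgt distrC; apply/negP; rewrite -ball_normE /= in hy.
have [x [Sx far_x]] := filter_ex (filterI FS Ffar).
exists (x :: s); split => /=; first by rewrite sz_s.
  by rewrite sep_s andbT; apply/allP.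
by move=> z; rewrite in_cons => /predU1P[->|/sS].
Qed.

(* The sets [|p| < e] on [[a, b]] generate a proper filter.  By
   [separated_points_bound] such a set is covered by less than [size p] balls
   whose radius tends to [0] with [e], so that an ultrafilter above it is Cauchy
   and converges to a root. *)
Lemma complete_approx_ivt_real_closed (R : realFieldType) :
    (forall F : set_system R, ProperFilter F -> cauchy F -> cvg F) ->
    (forall (p : {poly R}) (a b e : R), a <= b -> p.[a] <= 0 <= p.[b] ->
      0 < e -> exists2 x, a <= x <= b & `|p.[x]| < e) ->
  Num.real_closed_axiom R.
Proof.
move=> Rcomplete Rivt p a b ab pab.
have [->|p0] := eqVneq p 0; first by exists a; rewrite ?lexx ?root0.
pose S (e : R) := [set x | a <= x <= b /\ `|p.[x]| < e].
pose F0 := filter_from [set e : R | 0 < e] S.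
have F0P : ProperFilter F0.
  apply: filter_from_proper; last first.
    by move=> e e0; have [x ? ?] := Rivt p a b e ab pab e0; exists x.
  apply: filter_from_filter; first by exists 1 => /=.
  move=> e f /= e0 f0; exists (Num.min e f) => /=; first by rewrite lt_min e0.
  by move=> x [/= hx]; rewrite lt_min => /andP[? ?].
have [F [FU F0F]] := ultraFilterLemma F0P.
have FP : ProperFilter F by apply: ultra_proper.
have FS e : 0 < e -> F (S e) by move=> e0; apply: F0F; exists e.
have Fcauchy : cauchy F.
  apply: cauchy_exP => d d0; apply: contrapT => /forallNP Fball.
  pose n := size p; pose C := (2 / d) ^+ n.-1 : R.
  have C0 : 0 < C by rewrite exprn_gt0 // divr_gt0.
  have l0 : 0 < `|lead_coef p| by rewrite normr_gt0 lead_coef_eq0.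
  (* Chosen so that [C * e], the bound given by [separated_points_bound] for [size p] points, is
     only half of [|lead_coef p|]. *)
  pose e := `|lead_coef p| / 2 / C.
  have e0 : 0 < e by rewrite !divr_gt0.
  have [s [sz_s sep_s sS]] := ultra_separated FU Fball (FS e e0) n.
  have p_le : {in s, forall x, `|p.[x]| <= e} by move=> x /sS[_ /ltW].
  have := separated_points_bound d0 (ltW e0) sep_s (esym sz_s) p_le.
  rewrite sz_s -/C /e mulrC divfK ?gt_eqF // => h.
  suff : `|lead_coef p| / 2 < `|lead_coef p| by rewrite ltNge h.
  lra.
have /cvg_ex[x Fx] := Rcomplete F FP Fcauchy.
have close e e' : 0 < e -> 0 < e' -> exists2 y, S e y & `|x - y| < e'.
  move=> e0 e'0; have Fxe : F (ball x e') by apply: Fx; apply: nbhsx_ballx.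
  have [y [Sy]] := filter_ex (filterI (FS e e0) Fxe).
  by rewrite -ball_normE; exists y.
exists x.
  apply/andP; split; rewrite leNgt; apply/negP => hx.
    have [//||y [/andP[? ?] _]] := close 1 (a - x); first by rewrite subr_gt0.
    rewrite distrC ltr_norml; lra.
  have [//||y [/andP[? ?] _]] := close 1 (x - b); first by rewrite subr_gt0.
  rewrite ltr_norml; lra.
apply/rootP/eqP; rewrite -normr_le0 leNgt; apply/negP => px0.
(* Some [y] within distance [1] of [x] has both [|p.[y]|] and [L * |x - y|] below half of [|p.[x]|],
   which is absurd. *)
have [L L0 lip] := poly_lipschitz p (`|x| + 1).
pose e := `|p.[x]| / 2; pose e' := Num.min 1 (e / L).
have e0 : 0 < e by rewrite divr_gt0.
have e'0 : 0 < e' by rewrite lt_min ltr01 divr_gt0.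
have [y [_ py]] := close e e' e0 e'0.
rewrite lt_min ltr_pdivlMr // mulrC => /andP[xy1 xyL].
have /lip /(_ _) h : `|y| <= `|x| + 1.
  have := ler_normB x (x - y); rewrite opprB addrC subrK; lra.
have := h x; rewrite lerDl ler01 => /(_ isT) h'.
have : `|p.[x]| <= `|p.[y]| + `|p.[x] - p.[y]|.
  by have := ler_normD p.[y] (p.[x] - p.[y]); rewrite addrC subrK.
rewrite /e in py xyL; lra.
Qed.

(** * From sign changes over [Z] to small values over [R] *)

Definition discrete_ivt (Z : realDomainType) :=
  forall (f : {poly Z}) (m n : Z), m <= n -> f.[m] <= 0 -> 0 < f.[n] ->
  exists z : Z, [/\ m <= z, z + 1 <= n, f.[z] <= 0 & 0 < f.[z + 1]].

Definition has_floors (Z R : realDomainType) (e : Z -> R) :=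
  forall x : R, exists z : Z, e z <= x < e z + 1.

Lemma has_floors_above (Z R : realDomainType) (e : {rmorphism Z -> R}) :
  has_floors e -> forall x : R, exists z : Z, x < e z.
Proof.
move=> efloor x; have [z /andP[_ xz]] := efloor x.
by exists (z + 1); rewrite rmorphD rmorph1.
Qed.

(** Rounding down the coefficients of [D * p] changes each coefficient of [p] by at most [1 / D],
    hence values on [|x| <= B] by at most [S / D]; any [D > S / d] works. *)
Lemma poly_integer_approx (Z : realDomainType) (R : realFieldType)
    (e : {rmorphism Z -> R}) : has_floors e ->
  forall (p : {poly R}) (B d : R), 0 < d ->
  exists (D : Z) (c : {poly Z}), 0 < e D /\
    forall x, `|x| <= B -> `|p.[x] - (map_poly e c).[x] / e D| <= d.
Proof.
move=> efloor p B d d0.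
pose S := \sum_(i < size p) B ^+ i.
have [D] := has_floors_above efloor (Num.max 0 (S / d)).
rewrite gt_max ltr_pdivrMr // => /andP[D0 SD].
have [fl flP] := choice (fun k => efloor (p`_k * e D)).
exists D, (\poly_(k < size p) fl k); split=> // x xB.
have -> : (map_poly e (\poly_(k < size p) fl k)).[x] =
    \sum_(k < size p) e (fl k) * x ^+ k.
  rewrite -(horner_poly _ (fun k => e (fl k))); congr (_.[x]); apply/polyP => k.
  by rewrite coef_map /= !coef_poly; case: ifP => // _; rewrite rmorph0.
rewrite horner_coef mulr_suml -sumrB (le_trans (ler_norm_sum _ _ _)) //.
have : S / e D <= d by rewrite ler_pdivrMr // mulrC ltW.
apply: le_trans; rewrite mulr_suml ler_sum // => k _.
have -> : p`_k * x ^+ k - e (fl k) * x ^+ k / e D =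
    (p`_k * e D - e (fl k)) / e D * x ^+ k by field; rewrite gt_eqF.
rewrite normrM normrX normf_div (gtr0_norm D0) mulrAC ler_pM2r ?invr_gt0 //.
have /andP[fl1 fl2] := flP k.
rewrite -[leRHS]mul1r ler_pM ?exprn_ge0 //; first by rewrite ler_norml; lra.
by rewrite lerXn2r ?nnegrE // (le_trans _ xB).
Qed.

(** Homogenization: multiplying by a power of [N] clears the denominators at [n / N], so that signs
    on the grid of mesh [1 / N] are signs of a polynomial over [Z]. *)
Lemma poly_rescale (Z : realDomainType) (R : realFieldType)
    (e : {rmorphism Z -> R}) (c : {poly Z}) (N : Z) : e N != 0 ->
  exists f : {poly Z}, forall n : Z,
    e f.[n] = e N ^+ size c * (map_poly e c).[e n / e N].
Proof.
move=> N0; exists (\poly_(k < size c) (c`_k * N ^+ (size c - k))) => n.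
rewrite horner_poly rmorph_sum /=.
rewrite (@horner_coef_wide _ (size c)); last exact: size_poly.
rewrite mulr_sumr; apply: eq_bigr => k _.
rewrite coef_map /= !rmorphM !rmorphXn /= expr_div_n.
have -> : e N ^+ size c = e N ^+ (size c - k) * e N ^+ k.
  by rewrite -exprD subnK // ltnW.
by field; rewrite expf_neq0.
Qed.

(** With [q] within [d / 4] of [p], and a grid so fine that [p] varies by less than [d / 4] over one
    mesh, a sign change of [q] between neighbouring grid points forces [p] to be small there. *)
Lemma discrete_ivt_approx (Z : realDomainType) (R : realFieldType)
    (e : {rmorphism Z -> R}) :
    {mono e : x y / x <= y} -> has_floors e -> discrete_ivt Z ->
  forall (p : {poly R}) (a b d : R), a <= b -> p.[a] <= 0 <= p.[b] -> 0 < d ->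
  exists2 x, a <= x <= b & `|p.[x]| < d.
Proof.
move=> emono efloor Zivt p a b d; rewrite le_eqVlt => /predU1P[<-|ab].
  by rewrite -eq_le => /eqP pa d0; exists a; rewrite ?lexx // pa normr0.
move=> /andP[pa pb] d0.
(* An endpoint with a small value is itself a witness. Otherwise [q] has the right signs at the grid
   points next to [a] and [b]. *)
have [pad|pad] := ltP (- d) p.[a].
  by exists a; rewrite ?lexx ?ltW // ler0_norm // ltrNl.
have [pbd|pbd] := ltP p.[b] d.
  by exists b; rewrite ?lexx ?ltW // ger0_norm.
have emono_lt : {mono e : x y / x < y} := leW_mono emono.
pose B := `|a| + `|b|.
have inB x : a <= x <= b -> `|x| <= B.
  move=> /andP[? ?]; have := ler_norm b; have := ler_norm (- a).
  have := normr_ge0 a; have := normr_ge0 b; rewrite normrN ler_norml /B; lra.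
have [L L0 lip] := poly_lipschitz p B.
have d4 : 0 < d / 4 by rewrite divr_gt0.
have [D [c [D0 cp]]] := poly_integer_approx efloor p B d4.
pose q x := (map_poly e c).[x] / e D.
(* The first bound leaves room for two meshes in [[a, b]], the second makes the variation of [p]
   over one mesh less than [d / 4]. *)
have [N] := has_floors_above efloor (Num.max (2 / (b - a)) (L / (d / 4))).
rewrite gt_max => /andP[Nab NL].
have N0 : 0 < e N by apply: lt_trans Nab; rewrite divr_gt0 // subr_gt0.
have Vab : 2 * (e N)^-1 < b - a.
  by move: Nab; rewrite !ltr_pdivrMr ?subr_gt0 // mulrC.
have VL : L * (e N)^-1 < d / 4.
  by move: NL; rewrite !ltr_pdivrMr ?divr_gt0 // mulrC.
pose V := (e N)^-1; rewrite -/V in Vab VL; have V0 : 0 < V by rewrite invr_gt0.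
have [f fE] := poly_rescale c (lt0r_neq0 N0).
have f_sg n : (e f.[n] <= 0) = (q (e n * V) <= 0).
  by rewrite fE pmulr_rle0 ?exprn_gt0 // /q pmulr_lle0 ?invr_gt0.
have f_sg0 n : (f.[n] <= 0) = (q (e n * V) <= 0).
  by rewrite -f_sg -(rmorph0 e) emono.
have near x y : a <= x <= b -> a <= y <= b -> `|y - x| <= V ->
    `|p.[y] - q x| <= d / 2.
  move=> xab yab yx; have := lip x y (inB x xab) (inB y yab).
  have := cp x (inB x xab); rewrite -/(q x).
  have : L * `|y - x| <= L * V by rewrite ler_wpM2l // ltW.
  have := ler_normD (p.[y] - p.[x]) (p.[x] - q x); rewrite addrA subrK; lra.
have [m /andP[m1 m2]] := efloor (a * e N).
have [n /andP[n1 n2]] := efloor (b * e N).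
have hm : a < e (m + 1) * V /\ e (m + 1) * V <= a + V.
  rewrite ltr_pdivlMr // ler_pdivrMr // mulrDl mulVf ?gt_eqF //.
  by rewrite rmorphD rmorph1 lerD2r.
have hn : b - V < e n * V /\ e n * V <= b.
  rewrite ltr_pdivlMr // ler_pdivrMr // mulrBl mulVf ?gt_eqF //.
  by rewrite ltrBlDr.
have mn : m + 1 <= n by rewrite -emono -(ler_pM2r V0); lra.
have near_ab x y : a <= x -> x <= b -> a <= y -> y <= b ->
    - V <= y - x -> y - x <= V -> - (d / 2) <= p.[y] - q x <= d / 2.
  by move=> *; rewrite -ler_norml near ?ler_norml //; lra.
have [||z [mz zn fz]] := Zivt f (m + 1) n mn.
- rewrite f_sg0; have := near_ab (e (m + 1) * V) a; lra.
- rewrite ltNge f_sg0 -ltNge; have := near_ab (e n * V) b; lra.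
rewrite f_sg0 in fz.
rewrite ltNge f_sg0 -ltNge rmorphD rmorph1 mulrDl mul1r => fz1.
have zm : e (m + 1) * V <= e z * V by rewrite ler_pM2r // emono.
have zn' : e z * V + V <= e n * V.
  by rewrite -[X in _ + X]mul1r -mulrDl ler_pM2r // -(rmorph1 e) -rmorphD emono.
exists (e z * V); first lra.
(* The upper bound on [p] comes from [q <= 0] at the same grid point, the lower one from [q > 0] at
   the next. *)
have := near_ab (e z * V) (e z * V); have := near_ab (e z * V + V) (e z * V).
rewrite ltr_norml; lra.
Qed.

(** * Transfer of order and induction from [M] to [Z] *)

Lemma integers_of_inj (M : arith_struct) (hP : PAminus M) (Z : realDomainType)
  (i : M -> Z) (hZ : is_integers_of i) : injective i.
Proof.
move=> x y xy; have lt_xy := integers_of_lt hZ x y.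
have lt_yx := integers_of_lt hZ y x.
rewrite xy ltxx in lt_xy lt_yx.
by case: (pa_lt_total hP x y) => [/lt_xy|[|/lt_yx]].
Qed.

Lemma integers_of_le (M : arith_struct) (hP : PAminus M) (Z : realDomainType)
  (i : M -> Z) (hZ : is_integers_of i) (x y : M) : i x <= i y <-> (x <= y)%A.
Proof.
rewrite le_eqVlt; split.
  case/predU1P=> [/(integers_of_inj hP hZ)|/(integers_of_lt hZ)].
    by right.
  by left.
by case=> [/(integers_of_lt hZ) ->|->]; rewrite ?orbT ?eqxx.
Qed.

Lemma integers_of_ge0 (M : arith_struct) (Z : realDomainType)
  (i : M -> Z) (hZ : is_integers_of i) (x : M) : 0 <= i x.
Proof.
have : range i (i x) by exists x.
by rewrite (integers_of_range hZ).
Qed.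

Lemma integers_of_surj (M : arith_struct) (Z : realDomainType)
  (i : M -> Z) (hZ : is_integers_of i) (z : Z) :
  0 <= z -> exists x : M, i x = z.
Proof.
move=> z0; have : [set z | 0 <= z] z by [].
by rewrite -(integers_of_range hZ) => -[x _ <-]; exists x.
Qed.

Lemma integers_of_gt0 (M : arith_struct) (hP : PAminus M) (Z : realDomainType)
  (i : M -> Z) (hZ : is_integers_of i) (z : Z) : 0 < z -> 1 <= z.
Proof.
move=> z0; have [x xz] := integers_of_surj hZ (ltW z0).
rewrite -xz -(integers_of1 hZ); apply/(integers_of_le hP hZ).
apply: (pa_discrete hP); apply/(integers_of_lt hZ).
by rewrite (integers_of0 hZ) xz.
Qed.

Lemma integers_of_ltD1 (M : arith_struct) (hP : PAminus M) (Z : realDomainType)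
  (i : M -> Z) (hZ : is_integers_of i) (x y : Z) : (x < y) = (x + 1 <= y).
Proof.
apply/idP/idP => [xy|]; last by apply: lt_le_trans; rewrite ltrDl.
rewrite -lerBrDl; by apply: (integers_of_gt0 hP hZ); rewrite subr_gt0.
Qed.

(** Lets Delta_0 induction run on a predicate over [Z], where subtraction is available; the
    predicate has to match a bounded formula only on the image of [M]. *)
Lemma integers_of_induction (M : arith_struct) (hI : Delta0_induction M)
  (Z : realDomainType) (i : M -> Z) (hZ : is_integers_of i)
  (phi : bformula) (v : nat -> M) (P : Z -> Prop) :
    (forall x : M, sat (scons x v) phi <-> P (i x)) ->
    P 0 -> (forall z : Z, 0 <= z -> P z -> P (z + 1)) ->
  forall z : Z, 0 <= z -> P z.
Proof.
move=> phiP P0 PS z z0; have [x <-] := integers_of_surj hZ z0.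
apply/phiP; apply: hI => [|y /phiP Py]; apply/phiP.
  by rewrite (integers_of0 hZ).
rewrite (integers_ofD hZ) (integers_of1 hZ); apply: PS => //.
exact: integers_of_ge0.
Qed.

(* Value [sum_(k < n) v (s + 2 k) x ^ k] at [x = v 0]: the coefficients of the
   positive and of the negative part of a polynomial alternate in [v]. *)
Fixpoint horner_term (s n : nat) : term :=
  if n is n'.+1
  then TAdd (TVar s) (TMul (TVar 0) (horner_term s.+2 n')) else TZero.

Lemma teval_horner_term (M : arith_struct) (Z : realDomainType) (i : M -> Z)
  (hZ : is_integers_of i) (v : nat -> M) (s n : nat) :
  i (teval v (horner_term s n)) =
  \sum_(k < n) i (v (s + k.*2)%N) * i (v 0%N) ^+ k.
Proof.
elim: n s => [|n IHn] s /=; first by rewrite big_ord0 (integers_of0 hZ).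
rewrite (integers_ofD hZ) (integers_ofM hZ) IHn big_ord_recl addn0 mulr1.
congr (_ + _); rewrite mulr_sumr; apply: eq_bigr => k _.
by rewrite exprS mulrCA doubleS !addnS.
Qed.

(** Without such a sign change, [f <= 0] would propagate by induction from [0] up to [N]. As terms
    have no subtraction, [f.[z] <= 0] is expressed by comparing the positive and the negative part
    of [f]. *)
Lemma discrete_ivt0 (M : arith_struct) (hP : PAminus M)
  (hI : Delta0_induction M) (Z : realDomainType) (i : M -> Z)
  (hZ : is_integers_of i) (f : {poly Z}) (N : Z) :
    0 <= N -> f.[0] <= 0 -> 0 < f.[N] ->
  exists z : Z, [/\ 0 <= z, z + 1 <= N, f.[z] <= 0 & 0 < f.[z + 1]].
Proof.
move=> N0 f0 fN; apply: contrapT => nz.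
(* Once [scons] puts the argument in front, variable [1] is [N], and variables [2 + 2 k] and
   [3 + 2 k] are the negative and the positive part of the coefficient of degree [k]. *)
pose coefs (m : nat) : Z := if m is m'.+1
  then Num.max 0 ((-1) ^+ (~~ odd m') * f`_(m'./2)) else N.
have coefs_ge0 m : 0 <= coefs m.
  by case: m => //= m; rewrite le_max lexx.
have [v vE] := choice (fun m => integers_of_surj hZ (coefs_ge0 m)).
pose phi := FOr (FLt (TVar 1) (TVar 0))
  (FNot (FLt (horner_term 2 (size f)) (horner_term 3 (size f)))).
pose P z := N < z \/ f.[z] <= 0.
suff : P N by rewrite /P ltxx leNgt fN => -[].
apply: (integers_of_induction hI hZ (phi := phi) (v := v)) => //.
- move=> x; rewrite /= -[(v 0%N < x)%A](propext (integers_of_lt hZ _ _)).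
  rewrite vE /P /=.
  have -> : f.[i x] = i (teval (scons x v) (horner_term 3 (size f))) -
      i (teval (scons x v) (horner_term 2 (size f))).
    rewrite !teval_horner_term // -sumrB horner_coef; apply: eq_bigr => k _ /=.
    rewrite -mulrBl !vE /= odd_double /= uphalf_double doubleK.
    rewrite expr0 expr1 mul1r mulN1r.
    congr (_ * _); case: (leP 0 f`_k) => fk.
      by rewrite max_l ?subr0 // oppr_le0.
    by rewrite max_r ?sub0r ?opprK // oppr_ge0 ltW.
  rewrite subr_le0 leNgt; split=> -[h|h]; [by left|right|by left|right].
    by apply/negP => /(integers_of_lt hZ).
  by move=> /(integers_of_lt hZ); apply/negP.
- by right.
move=> z z0 [Nz|fz]; first by left; rewrite (lt_trans Nz) // ltrDl.
have [fz1|fz1] := leP f.[z + 1] 0; first by right.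
by left; rewrite ltNge; apply/negP => zN; apply: nz; exists z.
Qed.

Lemma integers_of_ivt (M : arith_struct) (hP : PAminus M)
  (hI : Delta0_induction M) (Z : realDomainType) (i : M -> Z)
  (hZ : is_integers_of i) : discrete_ivt Z.
Proof.
move=> f m n mn fm fn; pose g := f \Po ('X + m%:P).
have gE x : g.[x] = f.[x + m] by rewrite /g horner_comp !hornerE.
have [||| z [z0 zn gz gz1]] := discrete_ivt0 hP hI hZ (f := g) (N := n - m).
- by rewrite subr_ge0.
- by rewrite gE add0r.
- by rewrite gE subrK.
exists (z + m); rewrite gE in gz; rewrite gE addrAC in gz1; split=> //; lra.
Qed.

(** * Floors in [Q] and in [R] *)

(** For [b > 0], the floor of [a / b] is the place where the linear polynomial [b X - a] changes
    sign; since [b >= 1], this happens between [- |a|] and [|a| + 1]. *)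
Lemma fraction_field_floors (Z : realDomainType) (Q : realFieldType)
    (j : {rmorphism Z -> Q}) :
    is_ordered_fraction_field j -> (forall z : Z, 0 < z -> 1 <= z) ->
  discrete_ivt Z -> has_floors j.
Proof.
move=> hQ Zdiscr Zivt q.
have [a [b [b0 ->]]] := fraction_field_quot hQ q.
wlog b_gt0 : a b b0 / 0 < b => [hw|].
  have [/hw|b_lt0] := ltP 0 b; first exact.
  have := hw (- a) (- b); rewrite oppr_eq0 b0 oppr_gt0 lt_neqAle b0 b_lt0.
  by rewrite !rmorphN invrN mulrNN; apply.
have jmono := fraction_field_mono hQ.
have jb0 : 0 < j b by rewrite -(rmorph0 j) (leW_mono jmono).
pose f := b *: 'X - a%:P.
have fE x : f.[x] = b * x - a by rewrite /f !hornerE.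
have b1 := Zdiscr b b_gt0.
have := ler_norm a; have := ler_norm (- a); rewrite normrN => na pa.
have ba : `|a| <= b * `|a| by rewrite ler_peMl.
have [|||z [_ _]] := Zivt f (- `|a|) (`|a| + 1).
- lra.
- rewrite fE; lra.
- rewrite fE; lra.
rewrite !fE -(rmorph1 j) => bz bz1; exists z; rewrite -rmorphD.
rewrite ler_pdivlMr // ltr_pdivrMr // -!rmorphM jmono (leW_mono jmono); lra.
Qed.

(** By density some [q] of [Q] lies strictly between [x - 1] and [x]; if [n] is its floor, then
    [n < x < n + 2], so the floor of [x] is [n] or [n + 1]. *)
Lemma completion_floors (Z : realDomainType) (Q R : realFieldType)
    (j : {rmorphism Z -> Q}) (k : {rmorphism Q -> R}) :
    is_ordered_field_completion k -> has_floors j ->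
  has_floors (fun z => k (j z)).
Proof.
move=> hR jfloor x.
pose O := ball (x - 1 / 2) (1 / 2 : R).
have [|q' [xq [q _ qq']]] := completion_dense hR (O := O) _ (ball_open _ _).
  by exists (x - 1 / 2); apply: ballxx; rewrite divr_gt0.
move: xq; rewrite -qq' /O -ball_normE /= ltr_norml => xq.
have [n /andP[nq qn]] := jfloor q.
rewrite -(completion_mono hR) in nq.
rewrite -(leW_mono (completion_mono hR)) rmorphD rmorph1 in qn.
have [xn|xn] := ltP x (k (j n) + 1); first by exists n; lra.
by exists (n + 1); rewrite !rmorphD !rmorph1; lra.
Qed.

(** * Values and growth of the exponential on integers *)

(* The codes of the two sequences [x_1 = 1] and [y_1 = 2] are [X = 4] and
   [Y = 8]; there is no step to check, as [u_1 = 4 > y]. *)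
Lemma pow2_graph_1_2 (M : arith_struct) (hP : PAminus M) (Z : realDomainType)
  (i : M -> Z) (hZ : is_integers_of i) : @pow2_graph M 1%A 2%A.
Proof.
pose iE := (integers_ofM hZ, integers_ofD hZ, integers_of0 hZ, integers_of1 hZ).
have iI := integers_of_inj hP hZ.
have iLe x y : i x <= i y -> (x <= y)%A by move=> /(integers_of_le hP hZ).
have iLt x y : i x < i y -> (x < y)%A by move=> /(integers_of_lt hZ).
have Zdiscr := integers_of_gt0 hP hZ.
have i4 : i 4%A = 4 by rewrite !iE; ring.
have i2 : i 2%A = 2 by rewrite !iE.
have i8 : i (2 * 4)%A = 8 by rewrite iE i4 i2; ring.
have cases4 (x : M) : (x <= 4)%A ->
    [\/ i x = 0, i x = 1, i x = 2 | i x = 3 \/ i x = 4].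
  move=> /(integers_of_le hP hZ); rewrite i4 => x4.
  have x0 := integers_of_ge0 hZ x.
  have [|x1] := leP (i x) 0; first by constructor 1; lra.
  have [|x2] := leP (i x) 1; first by have := Zdiscr _ x1; constructor 2; lra.
  have [|x3] := leP (i x) 2.
    have := Zdiscr (i x - 1); rewrite subr_gt0 => /(_ x2) ?.
    by constructor 3; lra.
  have := Zdiscr (i x - 2); rewrite subr_gt0 => /(_ x3) ?.
  constructor 4; have [|x4'] := leP (i x) 3; first by left; lra.
  by have := Zdiscr (i x - 3); rewrite subr_gt0 => /(_ x4') ?; right; lra.
have le4 (x : M) : i x <= 4 -> (x <= 4)%A by rewrite -i4 => /iLe.
have nbit1 : ~ @bit_at M 1%A 4%A.
  move=> [q /cases4 q4 [r _ [/(integers_of_lt hZ) r1 /(congr1 i)]]].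
  have r0 := integers_of_ge0 hZ r; rewrite !iE in r1 *.
  have {}r0 : i r = 0.
    by apply: le_anti; rewrite r0 leNgt andbT; apply/negP => /Zdiscr; lra.
  rewrite r0; case: q4 => [->|->|->|[]->]; lra.
have nbit2 : ~ @bit_at M 2%A 4%A.
  move=> [q /cases4 q4 [r r4 [/(integers_of_lt hZ) r2 /(congr1 i)]]].
  have r0 := integers_of_ge0 hZ r; rewrite !iE in r2 *.
  case: q4 => [->|->|->|[]->]; lra.
have bit4 : @bit_at M 4%A 4%A.
  exists 0%A; first by apply: iLe; rewrite i4 iE; lra.
  exists 0%A; first by apply: iLe; rewrite i4 iE; lra.
  by split; [apply: iLt; rewrite i4 iE; lra|apply: iI; rewrite !iE; ring].
have tower_sum4 : @is_tower_sum M 4%A.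
  split=> //; split=> // x x4 [_ x_pow2] x2.
  suff -> : x = 4%A by split=> // _; left.
  have {}x2 : 2 < i x by rewrite -i2; apply/(integers_of_lt hZ).
  apply: (integers_of_inj hP hZ); rewrite i4.
  case: (cases4 x x4) => [||x3|[x3|//]]; try lra.
  (* The value [3] is no power of two: it divides itself, so [is_pow2] would make it even. *)
  have [|||q q3] := x_pow2 x.
  - by right.
  - by apply: iLt; rewrite iE x3; lra.
  - exists 1%A; first by apply: iLe; rewrite iE x3; lra.
    by apply: iI; rewrite !iE; lra.
  have /cases4 : (q <= 4)%A.
    by apply: le4; have /(integers_of_le hP hZ) := q3; lra.
  move=> q4 /(congr1 i); rewrite !iE x3; case: q4 => [->|->|->|[]->]; lra.
have tower4 : @is_tower M 4%A.
  split; last first.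
    by exists 4%A => //; apply: iLe; rewrite i8 i4; lra.
  split; first by apply: iLt; rewrite !iE; lra.
  move=> r r4 /(integers_of_lt hZ); rewrite iE => r1 [q q4 /(congr1 i)].
  rewrite i4 iE; case: (cases4 r r4) => [||r2|[r3|r4']]; try lra.
  - move=> _; exists 1%A; first by apply: iLe; rewrite iE; lra.
    by apply: iI; rewrite !iE; lra.
  - by rewrite r3; case: (cases4 q q4) => [->|->|->|[]->]; lra.
  move=> _; exists 2%A; first by apply: iLe; rewrite i2; lra.
  by apply: iI; rewrite !iE; lra.
have block4 (z w : M) : i w < 4 -> i z = i w * 4 -> block 4%A z w.
  move=> w4 zw; exists 0%A; first by apply: iLe; rewrite iE integers_of_ge0.
  exists 0%A; first by apply: iLe; rewrite iE integers_of_ge0.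
  split; first by apply: iLt; rewrite i4.
  split; first by apply: iLt; rewrite i4 iE; lra.
  by apply: iI; rewrite iE iE iE iE iE i4 zw; ring.
have block_X : @block M 4%A 4%A 1%A by apply: block4; rewrite ?i4 ?iE; lra.
have block_Y : @block M 4%A (2 * 4)%A 2%A by apply: block4; rewrite ?i8 i2; lra.
have i16 : i (2 * 2 * (2 * 2))%A = 16 by rewrite !iE; ring.
right; exists 4%A; first by apply: iLe; rewrite i4 i16; lra.
exists (2 * 4)%A; first by apply: iLe; rewrite i8 i16; lra.
do 3 (split=> //); last first.
  by exists 4%A; first right.
move=> u u2 [[u0 _] [m _ [[nb1 [nb2 _]] bu]]]; exfalso.
have {}u0 : 0 < i u by rewrite -(integers_of0 hZ); apply/(integers_of_lt hZ).
have u2' : i u <= 2 by rewrite -i2; apply/(integers_of_le hP hZ).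
have /cases4 : (u <= 4)%A by apply: le4; lra.
case=> [|u1|u1|[]]; try lra.
  by apply: nb1; rewrite -(_ : u = 1%A) //; apply: iI; rewrite iE.
by apply: nb2; rewrite -(_ : u = 2%A) //; apply: iI; rewrite i2.
Qed.

(* Induction on [x <= N] for [pow2_graph x y -> x < y], made Delta_0 by
   bounding [y] by [b = 2 ^ N]; the dummy [z = x] puts [x] and [y] in the places
   where [Fpow2_graph] expects them. *)
Lemma exp2_gt_integer (M : arith_struct) (hM : IDelta0_EXP M)
    (Z : realDomainType) (i : M -> Z) (hZ : is_integers_of i)
    (R : realFieldType) (e : {rmorphism Z -> R})
    (emono : {mono e : x y / x <= y})
    (exp2 : R -> R) (hexp2 : exponential_field exp2) :
    (forall n m : M, pow2_graph n m -> exp2 (e (i n)) = e (i m)) ->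
    exp2 1 = 2 ->
  forall z : Z, 0 <= z -> e z < exp2 (e z).
Proof.
case: hM => hP hI hE ext exp1.
have emono_lt : {mono e : x y / x < y} := leW_mono emono.
have exp_mono_le : {mono exp2 : x y / x <= y}.
  by move=> x y; rewrite !leNgt (exponential_mono hexp2).
(* Any value supplied by [EXP] must agree with [exp2], so the graph is recovered from [exp2] by
   injectivity of [i] and [e]. *)
have graphE x y : exp2 (e (i x)) = e (i y) -> pow2_graph x y.
  move=> xy; have [y' xy'] := hE x; suff -> : y = y' by [].
  apply: (integers_of_inj hP hZ); apply: (inc_inj emono).
  by rewrite -xy (ext _ _ xy').
have expE z : 0 <= z -> exists y, exp2 (e z) = e (i y).
  move=> z0; have [x <-] := integers_of_surj hZ z0.
  by have [y /ext] := hE x; exists y.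
move=> N N0; have [n nN] := integers_of_surj hZ N0; have [b bE] := expE N N0.
pose phi := FImp (FLt (TVar 0) (TAdd (TVar 1) TOne)) (FAll (TVar 2)
  (FEx (TVar 1) (FAnd (FEq (TVar 0) (TVar 2))
    (FImp Fpow2_graph (FLt (TVar 0) (TVar 1)))))).
pose v m := if m is 0%N then n else b.
have phiE x : sat (scons x v) phi <->
    ((x < n + 1)%A -> forall y, (y <= b)%A -> exists2 z, (z <= x)%A &
      z = x /\ (pow2_graph z y -> (z < y)%A)) by exact: iff_refl.
have xnE x : (x < n + 1)%A <-> i x <= N.
  rewrite -(integers_of_lt hZ) (integers_ofD hZ) (integers_of1 hZ) nN.
  by rewrite (integers_of_ltD1 hP hZ) lerD2r.
pose P z := z <= N -> e z < exp2 (e z).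
suff : P N by apply.
apply: (integers_of_induction hI hZ (phi := phi) (v := v)) => //.
- move=> x; rewrite phiE; split=> [Hx xN|Px /xnE xN y yb].
    have [y yE] := expE (i x) (integers_of_ge0 hZ x).
    have [||_ _ [-> xy]] := Hx _ y; first exact/xnE.
      apply/(integers_of_le hP hZ); rewrite -emono -yE -bE exp_mono_le.
      by rewrite emono.
    by rewrite yE emono_lt; apply/(integers_of_lt hZ)/xy/graphE.
  exists x; first by right.
  split=> // /ext xy; apply/(integers_of_lt hZ).
  by rewrite -emono_lt -xy; apply: Px.
- by rewrite /P rmorph0 (exponential0 hexp2) ltr01.
move=> z z0 Pz zN; have [w wE] := expE z z0.
(* Since [2 ^ z] is an integer above [z], [z + 1 <= 2 ^ z < 2 * 2 ^ z = 2 ^ (z + 1)]. *)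
have : e (z + 1) <= e (i w).
  rewrite emono -(integers_of_ltD1 hP hZ) -emono_lt -wE; apply: Pz.
  by rewrite (le_trans _ zN) // lerDl.
rewrite -wE => zw; apply: le_lt_trans zw _.
rewrite rmorphD rmorph1 (exponentialD hexp2) exp1.
have := exponential_gt0 hexp2 (e z); lra.
Qed.

(** * The exponential field and its integer part *)

Theorem corollary3p2
  (M : arith_struct) (hM : IDelta0_EXP M)
  (Z : realDomainType) (i : M -> Z) (hZ : is_integers_of i)
  (Q : realFieldType) (j : {rmorphism Z -> Q})
  (hQ : is_ordered_fraction_field j)
  (R : realFieldType) (k : {rmorphism Q -> R})
  (hR : is_ordered_field_completion k)
  (exp2 : R -> R) (hexp2 : exponential_field exp2)
  (exp2_extends : forall n m : M, pow2_graph n m ->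
    exp2 (k (j (i n))) = k (j (i m))) :
  real_closed_exponential_field exp2 /\
  exponential_integer_part exp2 (range (fun z : Z => k (j z))).
Proof.
have [hP hI hE] := hM.
pose e : {rmorphism Z -> R} := (k \o j)%FUN.
have emono : {mono e : x y / x <= y}.
  by move=> x y; rewrite /= (completion_mono hR) (fraction_field_mono hQ).
have emono_lt : {mono e : x y / x < y} := leW_mono emono.
have Zdiscr := integers_of_gt0 hP hZ.
have Zivt := integers_of_ivt hP hI hZ.
have efloor : has_floors e.
  exact: completion_floors hR (fraction_field_floors hQ Zdiscr Zivt).
have exp1 : exp2 1 = 2.
  have := exp2_extends _ _ (pow2_graph_1_2 hP hZ).
  rewrite (integers_ofD hZ) (integers_of1 hZ) -[k (j 1)]/(e 1).
  by rewrite -[k (j _)]/(e (1 + 1)) rmorphD rmorph1.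
have exp_gt := exp2_gt_integer hM hZ emono hexp2 exp2_extends exp1.
split; split=> //.
- apply: complete_approx_ivt_real_closed (completion_cauchy hR) _.
  exact: discrete_ivt_approx emono efloor Zivt.
- move=> x; have [x0|x0] := leP x 0.
    exact: le_lt_trans x0 (exponential_gt0 hexp2 x).
  have [z /andP[zx xz]] := efloor x.
  have z0 : 0 <= z.
    rewrite leNgt (integers_of_ltD1 hP hZ) -emono rmorphD rmorph1 rmorph0.
    rewrite -ltNge.
    exact: lt_trans xz.
  have [w wE] : exists w, exp2 (e z) = e w.
    have [n <-] := integers_of_surj hZ z0.
    by have [m /exp2_extends] := hE n; exists (i m).
  have := exp_gt z z0; rewrite wE emono_lt (integers_of_ltD1 hP hZ) -emono -wE.
  rewrite rmorphD rmorph1 => /(lt_le_trans xz) /lt_le_trans; apply.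
  by rewrite leNgt (exponential_mono hexp2) -leNgt.
- split.
  + split.
    * by rewrite inE; exists 1; rewrite // rmorph1 rmorph1.
    * move=> x y; rewrite !inE => -[a _ <-] [b _ <-]; exists (a - b) => //.
      by rewrite !rmorphB.
    * move=> x y; rewrite !inE => -[a _ <-] [b _ <-]; exists (a * b) => //.
      by rewrite !rmorphM.
  + move=> _ [a _ <-]; rewrite -[k _]/(e a) -{1}(rmorph0 e) -(rmorph1 e).
    by rewrite emono emono_lt; apply: Zdiscr.
  + move=> x; have [z /andP[zx xz]] := efloor x.
    exists (e z); first by exists z.
    by rewrite ler_norml; lra.
- move=> _ [a _ <-]; rewrite -[k _]/(e a) => a0.
  split; last exact: exponential_gt0.
  move: a0; rewrite -{1}(rmorph0 e) emono_lt => /ltW a0.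
  have [n <-] := integers_of_surj hZ a0.
  by have [m /exp2_extends mE] := hE n; exists (i m).
Qed.
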